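(* Let $v\ge 2$ be an integer with $\gcd(v,4)\neq 2$ and $\gcd(v,18)\neq 3$. Then there exists an AOA$(1,3,6,v)$.
   Context: An orthogonal array OA$(t,k,v)$ (with $1\le t\le k$) is a $v^t\times k$ array with entries from a set $X$ of size $v$ such that, for every choice of $t$ of its columns, each $t$-tuple in $X^t$ appears exactly once as a row of the corresponding $v^t\times t$ subarray. For integers $1\le s\le t\le k$, an augmented orthogonal array AOA$(s,t,k,v)$ is a $v^t\times(k+1)$ array $A$ such that: (1) the first $k$ columns of $A$ form an OA$(t,k,v)$ on a symbol set $X$ of size $v$; (2) the last column of $A$ has entries from a set $Y$ of size $v^{t-s}$; (3) for any choice of $s$ of the first $k$ columns, these $s$ columns together with the last column contain every $(s+1)$-tuple of $X^s\times Y$ exactly once as a row. *)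

(* Defs.v *)
From mathcomp Require Import all_boot.
Set Implicit Arguments. Unset Strict Implicit. Unset Printing Implicit Defensive.

Definition is_OA (t k v : nat) (A : 'I_(v ^ t) -> 'I_k -> 'I_v) : Prop :=
  forall c : 'I_t -> 'I_k, injective c ->
  forall x : 'I_t -> 'I_v,
    #|[set r : 'I_(v ^ t) | [forall j : 'I_t, A r (c j) == x j]]| = 1.

Definition is_AOA (s t k v : nat)
    (A : 'I_(v ^ t) -> 'I_k -> 'I_v) (L : 'I_(v ^ t) -> 'I_(v ^ (t - s))) : Prop :=
  [/\ 1 <= s, s <= t, t <= k,
      @is_OA t k v A &
      forall c : 'I_s -> 'I_k, injective c ->
      forall (x : 'I_s -> 'I_v) (y : 'I_(v ^ (t - s))),
        #|[set r : 'I_(v ^ t) | [forall j : 'I_s, A r (c j) == x j] && (L r == y)]| = 1].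

Definition AOA_exists (s t k v : nat) : Prop :=
  exists (A : 'I_(v ^ t) -> 'I_k -> 'I_v) (L : 'I_(v ^ t) -> 'I_(v ^ (t - s))),
    @is_AOA s t k v A L.

(* Main.v *)
Require Import Defs.
From HB Require Import structures.
From mathcomp Require Import all_boot all_algebra finfield.
From mathcomp Require Import zify ring.

(** The rows are indexed by [(g, (a, b))] in G * (G * G) for an abelian group G
    of order v, the last column being [(a, b)], and the six columns come in three
    pairs with entries [g + x0 u a], [g + x1 v a + b] and [g + x2 w a + s b],
    where [s] and [s - 1] are automorphisms of G.  Three columns that contain
    a pair determine [a] as soon as [x1 true - x1 false] (and likewise for x0,
    x2) is a permutation of G; for three columns from different pairs,
    eliminating [g] and [b] leaves [x2 w - s (x1 v) + (s - 1) (x0 u)], which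
    must be a permutation as well.  Over a field with at least four elements
    all these maps can be chosen linear.  In orders 12 and 24 no linear choice
    exists, because of the factor 3, but tabulated functions do the job.
    Products of arrays then give every v in which 2 does not divide exactly
    and 3 divides exactly only if 4 divides v. *)

Set Implicit Arguments. Unset Strict Implicit. Unset Printing Implicit Defensive.

Import GRing.Theory.

(** * Models over arbitrary finite types, and their products *)

(** Occurring exactly once is replaced by injectivity: for [s <= t] there are [v ^ t] tuples of
    either kind, as many as rows, so injectivity already makes every tuple occur. Free carrier types
    allow groups and products to serve directly. *)
Definition AOA_model (s t k v : nat) : Prop :=
  exists (X Y R : finType) (A : R -> 'I_k -> X) (L : R -> Y),
  [/\ #|X| = v, #|Y| = v ^ (t - s), #|R| = v ^ t,
      forall c : 'I_t -> 'I_k, injective c -> forall r r',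
        (forall j, A r (c j) = A r' (c j)) -> r = r' &
      forall c : 'I_s -> 'I_k, injective c -> forall r r',
        (forall j, A r (c j) = A r' (c j)) -> L r = L r' -> r = r'].

Arguments AOA_model (s t k v)%_nat_scope.

Lemma card_preim1_inj (R T : finType) (f : R -> T) (y : T) :
  injective f -> #|T| <= #|R| -> #|[set r | f r == y]| = 1.
Proof.
move=> f_inj leTR; have [g fK gK] := inj_card_bij f_inj leTR.
apply/eqP/cards1P; exists (g y); apply/setP=> r.
by rewrite !inE (can2_eq fK gK).
Qed.

Lemma AOA_exists_of_model s t k v :
  1 <= s -> s <= t -> t <= k -> AOA_model s t k v -> AOA_exists s t k v.
Proof.
move=> s1 st tk [X [Y [R [A [L [cX cY cR OA1 OA2]]]]]].
pose row (i : 'I_(v ^ t)) : R := enum_val (cast_ord (esym cR) i).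
pose toX (x : X) : 'I_v := cast_ord cX (enum_rank x).
pose toY (y : Y) : 'I_(v ^ (t - s)) := cast_ord cY (enum_rank y).
have row_inj : injective row.
  by apply: inj_comp; [exact: enum_val_inj | exact: cast_ord_inj].
have toX_inj : injective toX.
  by apply: inj_comp; [exact: cast_ord_inj | exact: enum_rank_inj].
have toY_inj : injective toY.
  by apply: inj_comp; [exact: cast_ord_inj | exact: enum_rank_inj].
exists (fun r i => toX (A (row r) i)), (fun r => toY (L (row r))).
split=> // [c c_inj x | c c_inj x y].
  pose f r := [ffun j => toX (A (row r) (c j))].
  have f_inj : injective f.
    move=> r r' /ffunP E; apply: row_inj; apply: (OA1 c c_inj) => j.
    by apply: toX_inj; have := E j; rewrite !ffunE.
  rewrite -(card_preim1_inj (finfun x) f_inj); last first.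
    by rewrite card_ffun !card_ord.
  apply: eq_card => r; rewrite !inE; apply/forallP/eqP => [E | E j].
    by apply/ffunP=> j; rewrite !ffunE; apply/eqP.
  by move/ffunP: E => /(_ j); rewrite !ffunE => /eqP.
pose f r := ([ffun j => toX (A (row r) (c j))], toY (L (row r))).
have f_inj : injective f.
  move=> r r' e; have /ffunP E := congr1 fst e.
  have /toY_inj EL := congr1 snd e; apply/row_inj/(OA2 c c_inj) => // j.
  by apply: toX_inj; have := E j; rewrite !ffunE.
rewrite -(card_preim1_inj (finfun x, y) f_inj); last first.
  by rewrite card_prod card_ffun !card_ord -expnD subnKC.
apply: eq_card => r; rewrite !inE xpair_eqE; congr (_ && _).
apply/forallP/eqP => [E | E j].
  by apply/ffunP=> j; rewrite !ffunE; apply/eqP.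
by move/ffunP: E => /(_ j); rewrite !ffunE => /eqP.
Qed.

Lemma AOA_model_mul s t k v w :
  AOA_model s t k v -> AOA_model s t k w -> AOA_model s t k (v * w).
Proof.
move=> [X [Y [R [A [L [cX cY cR OA1 OA2]]]]]].
move=> [X' [Y' [R' [A' [L' [cX' cY' cR' OA1' OA2']]]]]].
exists (X * X')%type, (Y * Y')%type, (R * R')%type.
exists (fun r i => (A r.1 i, A' r.2 i)), (fun r => (L r.1, L' r.2)).
split; rewrite ?card_prod ?expnMn; try congruence.
  move=> c c_inj [r1 r2] [r1' r2'] /= E.
  by congr (_, _); [apply: (OA1 c) | apply: (OA1' c)] => // j; case: (E j).
move=> c c_inj [r1 r2] [r1' r2'] /= E [EL EL'].
by congr (_, _); [apply: (OA2 c) | apply: (OA2' c)] => // j; case: (E j).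
Qed.

Lemma AOA_model1 s t k : AOA_model s t k 1.
Proof.
exists unit, unit, unit, (fun _ _ => tt), (fun _ => tt).
by split; rewrite ?card_unit ?exp1n // => c _ [] [].
Qed.

(** * The construction from three pairs of columns *)

(** Turns agreement of two rows in three arbitrary distinct columns into a count over six Booleans,
    which can be settled by enumeration. *)
Lemma three_of_six (b : pred 'I_6) (c : 'I_3 -> 'I_6) :
  injective c -> (forall j, b (c j)) ->
  2 < b (inord 0) + b (inord 1) + b (inord 2)
    + b (inord 3) + b (inord 4) + b (inord 5).
Proof.
move=> c_inj bc.
have : #|codom c| <= #|b|.
  by apply/subset_leq_card/subsetP => _ /codomP[j ->]; apply: bc.
rewrite card_codom // card_ord -sum1_card big_mkcond /=.
rewrite (eq_bigr (fun i => b i : nat)); last first.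
  by move=> i _; rewrite unfold_in; case: (b i).
rewrite !big_ord_recl big_ord0 addn0 !addnA.
by congr (_ < _ + _ + _ + _ + _ + _); congr (nat_of_bool (b _));
   apply: val_inj; rewrite /= inordK.
Qed.


Local Open Scope ring_scope.

Lemma addr2_solve (G : zmodType) (g g' x x' y y' : G) :
  g + (x + y) = g' + (x' + y') -> x' = x + ((g - g') + (y - y')).
Proof.
move=> e; have -> : x' = g' + (x' + y') - g' - y' by rewrite (addrC g') !addrK.
by rewrite -e addrCA -!addrA (addrCA y).
Qed.

Lemma AOA_model_three_pairs (G : finZmodType) (s : G -> G)
    (x0 x1 x2 : bool -> G -> G) :
  {morph s : a b / a - b} -> injective s -> injective (fun b => s b - b) ->
  injective (fun a => x0 true a - x0 false a) ->
  injective (fun a => x1 true a - x1 false a) ->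
  injective (fun a => x2 true a - x2 false a) ->
  (forall u v w : bool,
     injective (fun a => x2 w a - s (x1 v a) + (s (x0 u a) - x0 u a))) ->
  AOA_model 1 3 6 #|G|.
Proof.
move=> sB s_inj s1_inj x0_inj x1_inj x2_inj x012_inj.
(* The summands [0] give all six entries the shape [g + (x + y)] expected by [addr2_solve]. *)
pose entry (r : G * (G * G)) (i : nat) : G :=
  let: (g, (a, b)) := r in
  match i with
  | 0 => g + (x0 false a + 0) | 1 => g + (x0 true a + 0)
  | 2 => g + (x1 false a + b) | 3 => g + (x1 true a + b)
  | 4 => g + (x2 false a + s b) | _ => g + (x2 true a + s b)
  end.
exists G, (G * G)%type, (G * (G * G))%type.
exists (fun r i => entry r i), (fun r => r.2).
split; rewrite ?card_prod ?expnS ?expn0 ?muln1 //; last first.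
  move=> c _ [g [a b]] [g' [a' b']] /(_ ord0) + [? ?]; subst a' b'.
  by rewrite /entry; case: (c ord0) => [[|[|[|[|[|?]]]]] ?] /= /addIr ->.
move=> c c_inj [g [a b]] [g' [a' b']] E.
pose N i := entry (g, (a, b)) i == entry (g', (a', b')) i.
have := @three_of_six (fun i => N i) c c_inj.
move=> /(_ (fun j => introT eqP (E j))); rewrite !inordK // => cnt.
have s0 : s 0 = 0 by have := sB 0 0; rewrite !subrr.
have sD p q : s (p + q) = s p + s q.
  have -> : p + q = p - (0 - q) by rewrite sub0r opprK.
  by rewrite !sB s0 sub0r opprK.
pose be := b - b'; pose ga := g - g'.
have M0 (u : bool) : N u -> x0 u a' = x0 u a + ga.
  by case: u => /eqP/addr2_solve ->; rewrite subrr addr0.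
have M1 (u : bool) : N (2 + u)%N -> x1 u a' = x1 u a + (ga + be).
  by case: u => /eqP/addr2_solve ->.
have M2 (u : bool) : N (4 + u)%N -> x2 u a' = x2 u a + (ga + s be).
  by case: u => /eqP/addr2_solve ->; rewrite sB.
have pair (x : bool -> G -> G) z : injective (fun a => x true a - x false a) ->
    x true a' = x true a + z -> x false a' = x false a + z -> a' = a.
  move=> x_inj e1 e2; apply: x_inj => /=.
  by rewrite e1 e2 opprD addrACA subrr addr0.
have concl : a' = a -> be = 0 -> ga = 0 -> (g, (a, b)) = (g', (a', b')).
  by move=> -> /subr0_eq -> /subr0_eq ->.
have C0 (u : bool) : N u -> a' = a -> ga = 0.
  by move=> /M0 + e; rewrite e -[LHS]addr0 => /addrI.
have C1 (u : bool) : N (2 + u)%N -> a' = a -> ga + be = 0.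
  by move=> /M1 + e; rewrite e -[LHS]addr0 => /addrI.
have C2 (u : bool) : N (4 + u)%N -> a' = a -> ga + s be = 0.
  by move=> /M2 + e; rewrite e -[LHS]addr0 => /addrI.
have F01 (u v : bool) : N u -> N (2 + v)%N -> a' = a -> (g, (a, b)) = (g', (a', b')).
  move=> Nu Nv e; have ga0 := C0 u Nu e.
  by apply: concl => //; have := C1 v Nv e; rewrite ga0 add0r.
have F02 (u v : bool) : N u -> N (4 + v)%N -> a' = a -> (g, (a, b)) = (g', (a', b')).
  move=> Nu Nv e; have ga0 := C0 u Nu e.
  by apply/concl/ga0 => //; apply: s_inj; rewrite s0 -(C2 v Nv e) ga0 add0r.
have F12 (u v : bool) : N (2 + u)%N -> N (4 + v)%N -> a' = a ->
    (g, (a, b)) = (g', (a', b')).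
  move=> Nu Nv e; have e1 := C1 u Nu e; have e2 := C2 v Nv e.
  have be0 : be = 0.
    apply: s1_inj => /=; rewrite s0 subrr.
    by rewrite -[s be](addKr ga) e2 addr0 -opprD e1 oppr0.
  by apply: concl => //; move: e1; rewrite be0 addr0.
(* The combination cancels the three shifts: [(ga + s be) - s (ga + be) + (s ga - ga) = 0]. *)
have F012 (u v w : bool) : N u -> N (2 + v)%N -> N (4 + w)%N -> a' = a.
  move=> /M0 e0 /M1 e1 /M2 e2; apply: (x012_inj u v w) => /=.
  rewrite e0 e1 e2 (sD (x0 u a)) (sD (x1 v a)) (sD ga).
  rewrite (opprD (s (x1 v a))) (opprD (s ga)) (opprD (x0 u a)).
  rewrite [X in X + _ = _]addrACA [X in _ + X = _]addrACA.
  rewrite [LHS]addrACA -[RHS]addr0; congr (_ + _).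
  by rewrite [X in X + _ = _]addrACA subrr addr0 addrA subrK subrr.
have exN k : N k || N k.+1 -> exists u : bool, N (k + u)%N.
  by case/orP=> Nk; [exists false; rewrite addn0 | exists true; rewrite addn1].
have aE : a' = a.
  case: (boolP (N 0 && N 1)) => [/andP[/(M0 false) e0 /(M0 true) e1] | n01].
    exact: pair x0_inj e1 e0.
  case: (boolP (N 2 && N 3)) => [/andP[/(M1 false) e0 /(M1 true) e1] | n23].
    exact: pair x1_inj e1 e0.
  case: (boolP (N 4 && N 5)) => [/andP[/(M2 false) e0 /(M2 true) e1] | n45].
    exact: pair x2_inj e1 e0.
  (* At least three columns agree and no pair agrees entirely, so every pair contributes a
     column. *)
  have /and3P[/exN[u Nu] /exN[v Nv] /exN[w Nw]] :
      [&& N 0 || N 1, N 2 || N 3 & N 4 || N 5].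
    by move: cnt n01 n23 n45; do 6!case: (N _).
  exact: F012 Nu Nv Nw.
(* Three columns cannot all lie in one pair, and once [a' = a], columns from two different pairs
   determine [g] and [b]. *)
have /or3P[] : [|| (N 0 || N 1) && (N 2 || N 3), (N 0 || N 1) && (N 4 || N 5)
                 | (N 2 || N 3) && (N 4 || N 5)].
- by move: cnt; do 6!case: (N _).
- by case/andP=> /exN[u Nu] /exN[v Nv]; apply: F01 Nu Nv aE.
- by case/andP=> /exN[u Nu] /exN[v Nv]; apply: F02 Nu Nv aE.
- by case/andP=> /exN[u Nu] /exN[v Nv]; apply: F12 Nu Nv aE.
Qed.

(** * Linear choices over finite fields *)

(** With [u = s - 1] and the slope [- (u / s)] in the second pair, the map for three columns from
    different pairs is multiplication by [u * (x + i + j)], where [x] is [q] or [r] and [i], [j] are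
    0 or 1. Hence [q] and [r] need only be distinct and avoid 0, -1 and -2. *)
Lemma AOA_model_field (F : finFieldType) : (3 < #|F|)%N -> AOA_model 1 3 6 #|F|.
Proof.
move=> F4.
have ex_notin (A : {set F}) : (#|A| < #|F|)%N -> exists x, x \notin A.
  move=> ltA; apply/existsP; apply: contraTT ltA.
  rewrite negb_exists => /forallP A_all.
  rewrite -leqNgt -cardsT; apply/subset_leq_card/subsetP => x _.
  by have := A_all x; rewrite negbK.
have [s] : exists s : F, s \notin [set 0; 1].
  by apply: ex_notin; rewrite cards2; lia.
rewrite !inE negb_or => /andP[s0 s1].
pose S : {set F} := [set 0; -1; - 2%:R].
(* This leaves room for two elements outside [S]. In characteristic 2, [S] has at most two elements;
   otherwise [F] does not have order 4, hence has at least five elements. *)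
have leS : (#|S| < #|F|.-1)%N.
  case: (eqVneq (2%:R : F) 0) => [F2 | F2].
    by rewrite /S F2 oppr0 setUC setUA setUid cards2; lia.
  have : #|F| != 4%N.
    by apply/eqP => /(@card_finPcharP F 2 2) /(_ isT)/andP[_]; rewrite (negbTE F2).
  have : (#|S| <= 3)%N by rewrite /S setUC cardsU1 cards2; lia.
  by move: F4; lia.
have [q qS] : exists q : F, q \notin S by apply: ex_notin; lia.
have [r] : exists r : F, r \notin q |: S.
  by apply: ex_notin; rewrite cardsU1 qS; lia.
move: qS; rewrite !inE !negb_or => /andP[/andP[q0 q1] q2] /and3P[rq /andP[r0 r1] r2].
have linj (z : F) (f : F -> F) : z != 0 -> (forall a, f a = z * a) -> injective f.
  by move=> z0 fE a b; rewrite !fE => /(mulfI z0).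
pose u := s - 1; have u0 : u != 0 by rewrite subr_eq0.
apply: (@AOA_model_three_pairs F ( *%R s) (fun e a => if e then a else 0)
  (fun e a => if e then - (u / s) * a else 0)
  (fun e a => u * (if e then q else r) * a)).
- by move=> a b; rewrite mulrBr.
- exact: mulfI.
- by apply: (linj u) => // a; rewrite mulrBl mul1r.
- by apply: (linj 1) => [|a]; rewrite ?oner_neq0 // subr0 mul1r.
- by apply: (linj (- (u / s))) => [|a]; rewrite ?subr0 // oppr_eq0 mulf_neq0 ?invr_neq0.
- apply: (linj (u * (q - r))) => [|a]; last by ring.
  by rewrite mulf_neq0 // subr_eq0 eq_sym.
move=> v w e; set x := if e then q else r.
have [x0 x1 x2] : [/\ x != 0, x + 1 != 0 & x + 2%:R != 0].
  by rewrite /x; case: (e); rewrite !addr_eq0.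
apply: (linj (u * (x + v%:R + w%:R))) => [|a].
  rewrite mulf_neq0 //; case: (v); case: (w); rewrite ?addr0 //.
  by rewrite -addrA -natrD.
by case: (v); case: (w); rewrite /= ?mulr0 /u; field.
Qed.

Lemma AOA_model_prime_power p k :
  prime p -> (3 < p ^ k)%N -> AOA_model 1 3 6 (p ^ k)%N.
Proof.
case: k => [|k] // p_pr lt3; have [F _ cF] := pPrimePowerField p_pr (ltn0Sn k).
by rewrite -cF; apply: AOA_model_field; rewrite cF.
Qed.

(** * Tabulated functions and the orders 12 and 24 *)

(** Running over an explicit list makes injectivity decidable by [vm_compute]. *)
Definition all_injb (T U : eqType) (els : seq T) (f : T -> U) : bool :=
  all (fun a => all (fun b => (f a == f b) ==> (a == b)) els) els.

Lemma all_injbP (T U : eqType) (els : seq T) (f : T -> U) :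
  (forall a, a \in els) -> all_injb els f -> injective f.
Proof.
move=> els_all /allP f_inj a b /eqP fab.
by have /allP/(_ b (els_all b)) := f_inj a (els_all a); rewrite fab => /eqP.
Qed.

Definition tabulated (G : zmodType) (els t : seq G) (a : G) : G :=
  t`_(index a els).

(** One function in each of the first two pairs is normalised to 0 and [x0 true] to the identity,
    which leaves three tables; the condition on [x0] then holds by itself. *)
Definition three_pairs_check (G : zmodType) (s : G -> G) (els p q r : seq G) :=
  let x0 (u : bool) a := if u then a else 0 in
  let x1 (v : bool) a := if v then tabulated els p a else 0 in
  let x2 (w : bool) a := tabulated els (if w then r else q) a in
  let bools := [:: false; true] in
  [&& all_injb els s, all_injb els (fun b => s b - b),
      all_injb els (fun a => x1 true a - x1 false a),
      all_injb els (fun a => x2 true a - x2 false a) &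
      all (fun u => all (fun v => all (fun w => all_injb els
        (fun a => x2 w a - s (x1 v a) + (s (x0 u a) - x0 u a)))
        bools) bools) bools].

Lemma AOA_model_tables (G : finZmodType) (s : G -> G) (els p q r : seq G) :
  {morph s : a b / a - b} -> (forall a, a \in els) ->
  three_pairs_check s els p q r -> AOA_model 1 3 6 #|G|.
Proof.
move=> sB els_all /and5P[s_inj s1_inj x1_inj x2_inj x012_inj].
apply: (@AOA_model_three_pairs G s (fun u a => if u then a else 0)
  (fun v a => if v then tabulated els p a else 0)
  (fun w a => tabulated els (if w then r else q) a)) => //.
- exact: all_injbP s_inj.
- exact: all_injbP s1_inj.
- by move=> a b; rewrite !subr0.
- exact: all_injbP x1_inj.
- exact: all_injbP x2_inj.
move=> u v w; have inb (e : bool) : e \in [:: false; true] by case: e.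
apply: all_injbP els_all _; move/allP: x012_inj => /(_ u (inb u)).
by move=> /allP/(_ v (inb v))/allP/(_ w (inb w)).
Qed.

HB.instance Definition _ (U V : finZmodType) := Finite.on (U * V)%type.

(* The elements of Z_2^2 x Z_3 and Z_2^3 x Z_3 are numbered by [n]: the bits of
   [n %/ 3] give the first components and [n %% 3] the last one. *)
Definition elt12 (n : nat) : bool * bool * 'I_3 :=
  (odd (n %/ 6), odd (n %/ 3), inZp n).

Definition elt24 (n : nat) : bool * bool * bool * 'I_3 :=
  (odd (n %/ 12), odd (n %/ 6), odd (n %/ 3), inZp n).

(* In a suitable basis, multiplication by [(w, -1)] in F_4 x F_3, where
   [w^2 = w + 1]; likewise [twist24] in F_8 x F_3, where [w^3 = w + 1]. *)
Definition twist12 (a : bool * bool * 'I_3) : bool * bool * 'I_3 :=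
  let: (x, y, z) := a in (y, x (+) y, - z).

Definition twist24 (a : bool * bool * bool * 'I_3) : bool * bool * bool * 'I_3 :=
  let: (x, y, z, t) := a in (y, z, x (+) y, - t).

(* The tables of order 12 and 24 were found by a backtracking computer search;
   the one of order 24 assumed a symmetry of order 2. *)
Lemma AOA_model12 : AOA_model 1 3 6 12.
Proof.
pose G : finZmodType := (bool * bool * 'I_3)%type.
have <- : #|G| = 12%N by rewrite !card_prod card_bool card_ord.
apply: (@AOA_model_tables G twist12 (map elt12 (iota 0 12))
  (map elt12 [:: 0; 1; 2; 10; 9; 11; 5; 3; 4; 8; 7; 6])
  (map elt12 [:: 0; 8; 9; 1; 11; 4; 7; 10; 3; 2; 6; 5])
  (map elt12 [:: 0; 10; 4; 7; 1; 5; 11; 3; 6; 9; 8; 2]))%N.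
- move=> [[x y] z] [[x' y'] z']; congr (_, _, _); last by rewrite opprD.
  by move: x y x' y'; do 4!case.
- by move=> [[[] []] [[|[|[|//]]] ?]].
- by vm_compute.
Qed.

Lemma AOA_model24 : AOA_model 1 3 6 24.
Proof.
pose G : finZmodType := (bool * bool * bool * 'I_3)%type.
have <- : #|G| = 24%N by rewrite !card_prod card_bool card_ord.
apply: (@AOA_model_tables G twist24 (map elt24 (iota 0 24))
  (map elt24 [:: 0; 23; 1; 18; 19; 20; 9; 4; 14; 5; 22; 3;
                 17; 10; 15; 21; 16; 2; 6; 7; 8; 12; 11; 13])
  (map elt24 [:: 0; 21; 17; 10; 3; 19; 2; 20; 12; 5; 16; 1;
                 11; 22; 7; 8; 14; 18; 4; 9; 13; 6; 15; 23])
  (map elt24 [:: 0; 12; 19; 17; 10; 7; 22; 18; 2; 23; 5; 3;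
                 14; 8; 6; 13; 15; 11; 20; 1; 4; 9; 21; 16]))%N.
- move=> [[[x y] z] t] [[[x' y'] z'] t']; congr (_, _, _, _); last by rewrite opprD.
  by move: x y x' y'; do 4!case.
- by move=> [[[[] []] []] [[|[|[|//]]] ?]].
- by vm_compute.
Qed.

Local Close Scope ring_scope.

(** * Assembling all admissible orders from their factorisations *)

(** By strong induction: the full power of the smallest prime divisor comes from a field, and the
    cofactor keeps the valuations at its own primes. *)
Lemma AOA_model_prime_parts v :
  0 < v -> (forall p, prime p -> p %| v -> 3 < p ^ logn p v) -> AOA_model 1 3 6 v.
Proof.
elim/ltn_ind: v => v IHv v0 parts.
have [v_le1 | v_gt1] := leqP v 1.
  have -> : v = 1 by lia.
  exact: AOA_model1.
have p_pr := pdiv_prime v_gt1; set p := pdiv v in p_pr.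
have p_v : p %| v := pdiv_dvd v.
have [m co_pm def_v] := pfactor_coprime p_pr v0.
have lt3 := parts p p_pr p_v.
have m0 : 0 < m by rewrite lt0n; apply: contraTneq v0 => m0; rewrite def_v m0.
rewrite def_v; apply: AOA_model_mul; last exact: AOA_model_prime_power.
apply: IHv => // [|q q_pr q_m].
  by rewrite [ltnRHS]def_v ltn_Pmulr // (leq_trans _ lt3).
have -> : logn q m = logn q v.
  have pk0 : 0 < p ^ logn p v by apply: leq_trans lt3.
  rewrite [in RHS]def_v (lognM _ m0 pk0) lognX (logn_prime q p_pr).
  case: eqP => [e | _]; last by rewrite /= muln0 addn0.
  by move: co_pm; rewrite prime_coprime // -e q_m.
by apply: parts; rewrite // def_v dvdn_mulr.
Qed.

(** Primes above 3 are large enough by themselves; 2 and 3 occur with exponent at least 2 if at all,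
    and [p ^ 2] is at least 4. *)
Lemma AOA_model_valuations v :
  0 < v -> logn 2 v != 1 -> logn 3 v != 1 -> AOA_model 1 3 6 v.
Proof.
move=> v0 l2 l3; apply: AOA_model_prime_parts => // p p_pr p_v.
have l0 : 0 < logn p v by rewrite logn_gt0 mem_primes p_pr v0.
have [p_gt3 | p_le3] := ltnP 3 p.
  by apply: leq_trans p_gt3 _; rewrite -{1}(expn1 p) leq_exp2l ?prime_gt1.
have p_gt1 := prime_gt1 p_pr.
have l_gt1 : 1 < logn p v.
  by have /orP[] : (p == 2) || (p == 3) by [lia]; move=> /eqP e; rewrite e in l0 *; lia.
have le4 : p ^ 2 <= p ^ logn p v by rewrite leq_exp2l.
by apply: leq_trans le4; rewrite -mulnn; apply: (leq_mul p_gt1 p_gt1).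
Qed.

Theorem theorem2p9 (v : nat) :
  2 <= v -> gcdn v 4 != 2 -> gcdn v 18 != 3 -> AOA_exists 1 3 6 v.
Proof.
move=> v_ge2 gcd4 gcd18; apply: AOA_exists_of_model => //.
have v0 : 0 < v by apply: ltnW.
have l2 : logn 2 v != 1.
  apply: contra gcd4 => /eqP l2; have [m co def_v] := pfactor_coprime (isT : prime 2) v0.
  rewrite def_v l2 expn1 -[4]/(2 * 2) -muln_gcdl.
  by move: co; rewrite coprime_sym /coprime => /eqP ->.
have [l3 | l3] := eqVneq (logn 3 v) 1; last exact: AOA_model_valuations.
(* An odd [v] divisible by 3 exactly once would have [gcdn v 18 = 3]; so [v] is even, and [l2] then
   makes it divisible by 4. *)
have l2_gt1 : 1 < logn 2 v.
  suff : 0 < logn 2 v by lia.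
  rewrite logn_gt0 mem_primes v0 /= dvdn2; apply: contra gcd18 => odd_v.
  have [m co def_v] := pfactor_coprime (isT : prime 3) v0.
  rewrite l3 expn1 in def_v; rewrite def_v -[18]/(6 * 3) -muln_gcdl.
  suff /eqP -> : coprime m (2 * 3) by [].
  rewrite coprimeMr coprimen2 (coprime_sym m 3) co andbT.
  by move: odd_v; rewrite def_v oddM andbT.
(* The cofactor of [n] has valuation 0 at 3 and a valuation other than 1 at 2, so fields suffice for
   it. *)
have split_off n : 0 < n -> n %| v -> logn 3 n = 1 -> logn 2 v != (logn 2 n).+1 ->
    AOA_model 1 3 6 n -> AOA_model 1 3 6 v.
  move=> n0 /dvdnP[m def_v] l3n l2n n_model.
  have m0 : 0 < m by rewrite lt0n; apply: contraTneq v0 => m0; rewrite def_v m0.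
  rewrite def_v; apply: AOA_model_mul => //.
  move: l3 l2n; rewrite def_v !lognM // l3n => l3 l2n.
  by apply: AOA_model_valuations => //; lia.
have dvd3 : 3 %| v by rewrite -(expn1 3) pfactor_dvdn // l3.
have dvd2 k : k <= logn 2 v -> 2 ^ k * 3 %| v.
  move=> lek; rewrite Gauss_dvd ?pfactor_dvdn ?lek //.
  by rewrite coprimeXl.
(* Removing 12 leaves a single factor 2 exactly when [logn 2 v] is 3; removing 24 then leaves an odd
   cofactor. *)
have [l2_3 | l2_3] := eqVneq (logn 2 v) 3.
  by apply: (split_off 24) AOA_model24 => //; rewrite ?l2_3 // (dvd2 3) ?l2_3.
exact: (split_off 12 _ (dvd2 2 l2_gt1)) AOA_model12.
Qed.
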